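(* For $\alpha,\nu\in[0,1)$ and integers $r,m$ with $1\le r\le m$, $$\lim_{n\to\infty}\frac{1}{n}\mathcal{N}_{n,\alpha,\nu,r,m} = \begin{cases} \dfrac{-\alpha}{1-\alpha}+\displaystyle\int_0^1\frac{(1-x)x^{-\alpha}}{1-x^m}\,dx & \text{if } r=1,\\[2ex] \displaystyle\int_0^1\frac{(1-x)x^{r-1-\alpha}}{1-x^m}\,dx & \text{if } 2\le r\le m.\end{cases}$$
   Context: For positive integers $n,m$, $r\in\mathbb{Z}$ and $\alpha,\nu\in\mathbb{R}$, define $$\mathcal{N}_{n,\alpha,\nu,r,m}=\#\left\{k\in\mathbb{Z} : 1\le k\le n,\ \left\lfloor\frac{n-\nu}{k}+\alpha\right\rfloor\equiv r \pmod m\right\},$$ where $\lfloor\cdot\rfloor$ is the floor function. *)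

(* Defs.v *)
From HB Require Import structures.
From mathcomp Require Import all_boot all_order all_algebra.
From mathcomp Require Import all_classical all_reals all_analysis.
Import Order.TTheory GRing.Theory Num.Theory.
Import numFieldNormedType.Exports.

Set Implicit Arguments.
Unset Strict Implicit.
Unset Printing Implicit Defensive.

Local Open Scope ring_scope.

(* The integers k with 1 <= k <= n are encoded as the nonzero elements of
   'I_n.+1. *)
Definition floor_count (R : realType) (n : nat) (alpha nu : R) (r : int)
    (m : nat) : nat :=
  #|[pred k : 'I_n.+1 | (1 <= k)%N &&
      (Num.floor ((n%:R - nu) / (k : nat)%:R + alpha) == r %[mod m%:Z])%Z]|.

(* Main.v *)
Require Import Defs.
From mathcomp Require Import all_boot all_order all_algebra.
From mathcomp Require Import all_classical all_reals all_analysis.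
From mathcomp Require Import measurable_realfun zify ring lra.
Import Order.TTheory GRing.Theory Num.Theory.
Import numFieldNormedType.Exports.
Local Open Scope classical_set_scope.
Local Open Scope ring_scope.

(* For j >= 1 the number of k <= n with floor ((n - nu) / k + alpha) >= j is
   min (n, floor ((n - nu) / (j - alpha))) = n * min (1, 1 / (j - alpha)) + O(1).
   Hence I consecutive terms of the progression r, r + m, ... contribute
   n * sum_(i < I) (1 / (r + i m - alpha) - 1 / (r + i m + 1 - alpha)) + O(I),
   except that for r = 1 the first summand 1 / (1 - alpha) is truncated to 1,
   whence the extra term - alpha / (1 - alpha); the values >= r + I m are taken by
   at most n / (r + I m - alpha) + O(1) integers k.  Expanding 1 / (1 - x^m) as a
   geometric series shows that the integral differs from the same partial sum by
   at most 1 / (r + I m - alpha).  Let n, then I, go to infinity. *)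

(** * Integrals of real powers over the unit interval *)

Lemma continuous_powR {R : realType} (s x : R) : 0 < x ->
  {for x, continuous (fun y : R => y `^ s)}.
Proof.
move=> x0; apply: differentiable_continuous; apply/derivable1_diffP.
by apply: derivable_powR; rewrite in_itv/= andbT.
Qed.

Lemma is_derive_powR_primitive {R : realType} (s x : R) : 0 < x -> s + 1 != 0 ->
  is_derive x 1 (fun y : R => (s + 1)^-1 * y `^ (s + 1)) (x `^ s).
Proof.
move=> x0 s1; have dx := is_derive1_powR (s + 1) x0.
have := is_deriveZ (s + 1)^-1 dx.
by rewrite /GRing.scale/= mulrA mulVf// mul1r addrK.
Qed.

(** For [s < 0] the integrand is unbounded near 0, so the fundamental theorem of calculus is applied
    on [[e n, 1]] and these intervals are exhausted by monotone convergence. *)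
Lemma integral_powR_01 {R : realType} (s : R) : -1 < s ->
  (\int[@lebesgue_measure R]_(x in `]0%R, 1%R[) (x `^ s)%:E = (s + 1)^-1%:E)%E.
Proof.
move=> s1; have s10 : 0 < s + 1 by lra.
have mf (D : set R) : measurable_fun D (EFin \o (fun x : R => x `^ s)).
  by apply/measurable_EFinP; apply: measurable_funTS; exact: measurable_powR.
(* The shift by 2 gives [e n < 1] already at [n = 0], so every interval is nondegenerate. *)
pose e n : R := n.+2%:R^-1.
have e0 n : 0 < e n by rewrite invr_gt0.
have e1 n : e n < 1 by rewrite invf_lt1// ltr1n.
pose F n := `[e n, 1]%classic.
rewrite integral_itv_bndo_bndc; last exact: mf.
have bF : `]0%R, 1%R]%classic = \bigcup_n F n.
  apply/seteqP; split => [x|x [n _]] /=; rewrite /F/= !in_itv/= => /andP[x0 x1].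
    have xV0 : 0 <= x^-1 by rewrite invr_ge0 ltW.
    exists (Num.truncn x^-1) => //=; rewrite in_itv/= x1 andbT.
    rewrite /e invf_ple ?posrE ?ltr0n//.
    have /andP[_ /ltW] := truncn_itv xV0 => /le_trans; apply.
    by rewrite ler_nat.
  by rewrite x1 (lt_le_trans (e0 n)).
rewrite bF.
have ndF : nondecreasing_seq F.
  move=> n p np; rewrite subsetEset => x.
  rewrite /F/= !in_itv/= => /andP[xn ->].
  by rewrite andbT (le_trans _ xn)// lef_pV2 ?posrE// ler_nat.
have f0 n x : F n x -> (0%:E <= (x `^ s)%:E)%E.
  by move=> _; rewrite lee_fin powR_ge0.
have mF n : measurable (F n : set (measurableTypeR R)) by exact: measurable_itv.
have /cvg_lim <- // := ge0_nondecreasing_set_cvg_integral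
  (mu := lebesgue_measure) ndF mF (fun n => mf (F n)) f0.
rewrite (_ : (fun _ => _) =
    (fun n => ((s + 1)^-1 - (s + 1)^-1 * e n `^ (s + 1))%:E)); last first.
  apply/funext => n.
  rewrite (@continuous_FTC2 _ _ (fun y : R => (s + 1)^-1 * y `^ (s + 1)))//.
  + by rewrite powR1 mulr1 EFinB.
  + apply: derivable_within_continuous.
    move=> x; rewrite in_itv/= => /andP[xe _].
    by apply: derivable_powR; rewrite in_itv/= andbT (lt_le_trans (e0 n)).
  + have dF x : 0 < x -> derivable (fun y : R => (s + 1)^-1 * y `^ (s + 1)) x 1.
      move=> x0; apply: (@ex_derive _ _ _ _ _ _ (x `^ s)).
      by apply: is_derive_powR_primitive => //; rewrite gt_eqF.
    have cF x : 0 < x ->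
        {for x, continuous (fun y : R => (s + 1)^-1 * y `^ (s + 1))}.
      by move=> x0; apply: differentiable_continuous; apply/derivable1_diffP/dF.
    split.
    * move=> x; rewrite in_itv/= => /andP[xe _].
      by apply: dF; rewrite (lt_trans (e0 n)).
    * exact/cvg_at_right_filter/cF.
    * exact/cvg_at_left_filter/cF.
  + move=> x; rewrite in_itv/= => /andP[xe _]; rewrite derive1E.
    have x0 : 0 < x by rewrite (lt_trans (e0 n)).
    by have [] := @is_derive_powR_primitive R s x x0 (lt0r_neq0 s10).
apply/cvg_lim => //; apply: cvg_EFin; first exact: nearW.
rewrite -[X in _ --> X]subr0; apply: cvgB; first exact: cvg_cst.
rewrite -[X in _ --> X](mulr0 (s + 1)^-1); apply: cvgMl_tmp.
(* The boundary term at [e n] vanishes in the limit because [s + 1 > 0]; [e] is the harmonic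
   sequence shifted by one. *)
have /cvg_at_rightP := powR_cvg0 s10; apply.
split=> //; have := @cvg_harmonic R.
by rewrite -(cvg_shiftS (@harmonic R)).
Qed.

Lemma integrable_powR_01 {R : realType} (s : R) : -1 < s ->
  (@lebesgue_measure R).-integrable `]0, 1[ (EFin \o (fun x : R => x `^ s)).
Proof.
move=> s1; apply/integrableP; split.
  by apply/measurable_EFinP; apply: measurable_funTS; exact: measurable_powR.
under eq_integral do rewrite /= ger0_norm ?powR_ge0//.
by rewrite integral_powR_01// ltry.
Qed.

Lemma Rintegral_powR_01 {R : realType} (s : R) : -1 < s ->
  \int[@lebesgue_measure R]_(x in `]0, 1[) (x `^ s) = (s + 1)^-1.
Proof. by move=> s1; rewrite /Rintegral integral_powR_01. Qed.

Lemma integrable_powR_sum_01 {R : realType} (s : R) (m I : nat) : -1 < s ->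
  (@lebesgue_measure R).-integrable `]0, 1[ (EFin \o (fun x : R =>
    \sum_(i < I) (x `^ (s + (i * m)%:R) - x `^ (s + 1 + (i * m)%:R)))).
Proof.
move=> s1.
apply: (eq_integrable _ (fun x : measurableTypeR R => \sum_(i < I)
    ((x `^ (s + (i * m)%:R))%:E - (x `^ (s + 1 + (i * m)%:R))%:E)%E)) => //.
  by move=> x _; rewrite /= -sumEFin.
apply: integrable_sum => // i _; have im0 := ler0n R (i * m).
by apply: integrableB => //; apply: integrable_powR_01; lra.
Qed.

Lemma Rintegral_powR_sum_01 {R : realType} (s : R) (m I : nat) : -1 < s ->
  \int[@lebesgue_measure R]_(x in `]0, 1[)
    (\sum_(i < I) (x `^ (s + (i * m)%:R) - x `^ (s + 1 + (i * m)%:R))) =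
  \sum_(i < I) ((s + 1 + (i * m)%:R)^-1 - (s + 2 + (i * m)%:R)^-1).
Proof.
move=> s1; elim: I => [|I IH].
  rewrite big_ord0; under eq_Rintegral do rewrite big_ord0.
  by rewrite Rintegral_cst// mul0r.
under eq_Rintegral do rewrite big_ord_recr/=.
have im0 := ler0n R (I * m).
rewrite RintegralD//; last 2 first.
- exact: integrable_powR_sum_01.
- apply: (@integrableB _ _ _ lebesgue_measure `]0, 1[ _
      (fun x => (x `^ _)%:E) (fun x => (x `^ _)%:E)) => //;
    by apply: integrable_powR_01; lra.
rewrite RintegralB//; [|by apply: integrable_powR_01; lra..].
rewrite IH big_ord_recr/= !Rintegral_powR_01; [|lra..].
by congr (_ + (_^-1 - _^-1)); ring.
Qed.

(** * The integral kernel and its geometric expansion *)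

Section digamma_kernel.
Context {R : realType} (s : R) (m : nat).
Hypotheses (s1 : -1 < s) (m0 : (0 < m)%N).

Let f (x : R) := (1 - x) * x `^ s / (1 - x ^+ m).
Let S (I : nat) (x : R) :=
  \sum_(i < I) (x `^ (s + (i * m)%:R) - x `^ (s + 1 + (i * m)%:R)).

(* Geometric series in [x ^+ m], with remainder [x ^+ (I * m) * f x]. *)
Lemma kernel_sum_bounds (I : nat) (x : R) : 0 < x < 1 ->
  S I x <= f x <= S I x + x `^ (s + (I * m)%:R).
Proof.
move=> /andP[x0 x1]; set q := x ^+ m.
have xD t k : x `^ (t + (k * m)%:R) = x `^ t * q ^+ k.
  rewrite powRD; last by apply/implyP => _; rewrite gt_eqF.
  by rewrite powR_mulrn ?ltW// mulnC exprM.
have q0 : 0 < q by rewrite exprn_gt0.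
have qx : q <= x by rewrite /q -[leRHS]expr1 ler_wiXn2l// ltW.
have q1 : 0 < 1 - q by rewrite subr_gt0 (le_lt_trans qx).
have SE : S I x = f x * (1 - q ^+ I).
  rewrite /S (eq_bigr (fun i : 'I_I => x `^ s * (1 - x) * q ^+ i)); last first.
    move=> i _; rewrite !xD powRD; last by apply/implyP => _; rewrite gt_eqF.
    by rewrite powRr1 ?ltW//; ring.
  have -> : 1 - q ^+ I = (1 - q) * \sum_(i < I) q ^+ i.
    by rewrite -opprB subrX1 -mulNr opprB.
  by rewrite -mulr_sumr /f -/q; field; rewrite gt_eqF.
have xs0 : 0 < x `^ s by rewrite powR_gt0.
have f0 : 0 <= f x by rewrite /f divr_ge0 ?mulr_ge0 ?ltW// subr_gt0.
(* From [q <= x] follows [(1 - x) / (1 - q) <= 1]; this is what bounds the remainder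
   [q ^+ I * f x]. *)
have fs : f x <= x `^ s.
  by rewrite /f ler_pdivrMr// mulrC ler_wpM2l ?lerB// ltW.
have qI : 0 < q ^+ I by rewrite exprn_gt0.
by rewrite xD SE; nra.
Qed.

Lemma measurable_kernel : measurable_fun (`]0, 1[ : set R) f.
Proof.
apply: open_continuous_measurable_fun; first exact: interval_open.
move=> x; rewrite inE/= in_itv/= => /andP[x0 x1].
apply: cvgM.
  apply: cvgM; last exact: continuous_powR.
  by apply: cvgB; [exact: cvg_cst|exact: cvg_id].
apply: cvgV; first by rewrite gt_eqF// subr_gt0 exprn_ilt1// ?ltW// -lt0n.
by apply: cvgB; [exact: cvg_cst|exact: exprn_continuous].
Qed.

Lemma integrable_kernel :
  (@lebesgue_measure R).-integrable `]0, 1[ (EFin \o f).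
Proof.
apply: (le_integrable _ _ _ (integrable_powR_01 s s1)) => //.
  by apply/measurable_EFinP; exact: measurable_kernel.
(* At [I = 0] the sum is empty and the bounds give domination by the integrable power of exponent
   [s]. *)
move=> x; rewrite /= in_itv/= => x01; have := kernel_sum_bounds 0 x x01.
rewrite /S big_ord0 add0r mul0n addr0 lee_fin => /andP[f0 fs].
by rewrite !ger0_norm// powR_ge0.
Qed.

(** Integrating the pointwise bounds leaves an explicit error that vanishes as [I] grows, so no
    limit has to be interchanged with the integral. *)
Lemma Rintegral_kernel_bounds (I : nat) :
  let T := \sum_(i < I) ((s + 1 + (i * m)%:R)^-1 - (s + 2 + (i * m)%:R)^-1) in
  T <= \int[@lebesgue_measure R]_(x in `]0, 1[) f x <=
  T + (s + 1 + (I * m)%:R)^-1.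
Proof.
have im0 := ler0n R (I * m); have sI : -1 < s + (I * m)%:R by rewrite ltr_wpDr.
rewrite /= -Rintegral_powR_sum_01//; apply/andP; split.
  apply: le_Rintegral => //; first exact: integrable_powR_sum_01.
    exact: integrable_kernel.
  by move=> x; rewrite /= in_itv/= => /(kernel_sum_bounds I)/andP[].
rewrite addrAC -Rintegral_powR_01// -RintegralD//; last 2 first.
- exact: integrable_powR_sum_01.
- exact: integrable_powR_01.
apply: le_Rintegral => //; first exact: integrable_kernel.
  apply: (@integrableD _ _ _ lebesgue_measure `]0, 1[ _ (EFin \o S I)
      (fun x => (x `^ _)%:E)) => //.
    exact: integrable_powR_sum_01.
  exact: integrable_powR_01.
by move=> x; rewrite /= in_itv/= => /(kernel_sum_bounds I)/andP[].
Qed.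

End digamma_kernel.

(** * Counting a residue class along an arithmetic progression *)

Lemma sum_eq_progression (m r w I : nat) : (0 < m)%N ->
  (\sum_(i < I) (w == r + i * m)%N =
   [&& w == r %[mod m], r <= w & w < r + I * m])%N.
Proof.
move=> m0; elim: I => [|I IH].
  by rewrite big_ord0 mul0n addn0; case: (leqP r w); rewrite ?andbF.
rewrite big_ord_recr/= {}IH.
have [rw|wr] /= := leqP r w; last first.
  by rewrite andbF/= ltn_eqF// ltn_addr.
have [P|nP]/= := boolP (w == r %[mod m])%N; last first.
  rewrite add0n; apply/eqP; rewrite eqb0; apply: contra nP => /eqP ->.
  by rewrite addnC modnMDl.
move: P; rewrite eqn_mod_dvd// => /dvdnP[q wE].
(* In terms of the index [q] the goal becomes [(q < I) + (q == I) = (q < I.+1)]. *)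
have -> : w = (r + q * m)%N by rewrite -wE subnKC.
rewrite !ltn_add2l eqn_add2l !ltn_pmul2r// eqn_pmul2r//.
by lia.
Qed.

(** As [r <= m], a value congruent to [r] and smaller than [r] can only be 0, with [r = m]; the
    summand [w < 1] absorbs this case. *)
Lemma residue_indicator_bounds (m r w I : nat) : (0 < m)%N -> (r <= m)%N ->
  (\sum_(i < I) (w == r + i * m) <= (w == r %[mod m]) <=
   \sum_(i < I) (w == r + i * m) + (r + I * m <= w) + (w < 1))%N.
Proof.
move=> m0 rm; rewrite sum_eq_progression//.
have [P|nP] //= := boolP (w == r %[mod m])%N.
apply/andP; split; first by case: (_ && _).
have [w0|w0] := ltnP w 1; first by rewrite /= addn1.
have [rw|wr] /= := leqP r w; first by case: (ltnP w (r + I * m)).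
have wm : (w < m)%N by exact: leq_trans wr rm.
move: P; rewrite (modn_small wm).
have [rm'|] := ltnP r m; first by rewrite modn_small// => /eqP; lia.
move=> mr; have -> : r = m by lia.
by rewrite modnn => /eqP; lia.
Qed.

(** The indicator bounds are summed over [k], with [w k = j] counted by [A j - A j.+1] and [w k < 1]
    by the size of [Q] minus [A 1]. Terms are moved across the inequalities to avoid truncated
    subtraction on [nat]. *)
Lemma residue_count_bounds (T : finType) (Q : pred T) (w : T -> nat)
    (m r I : nat) : (0 < m)%N -> (r <= m)%N ->
  let A j := (\sum_(k | Q k) (j <= w k))%N in
  let N := (\sum_(k | Q k) (w k == r %[mod m]))%N in
  (\sum_(i < I) A (r + i * m) <= N + \sum_(i < I) A (r + i * m).+1)%N /\
  (N + \sum_(i < I) A (r + i * m).+1 + A 1 <=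
     \sum_(i < I) A (r + i * m) + A (r + I * m) + \sum_(k | Q k) 1)%N.
Proof.
move=> m0 rm A N.
pose E := (\sum_(k | Q k) \sum_(i < I) (w k == r + i * m))%N.
have AE : (\sum_(i < I) A (r + i * m) = E + \sum_(i < I) A (r + i * m).+1)%N.
  rewrite /E [X in _ = (X + _)%N]exchange_big -big_split/=.
  apply: eq_bigr => i _.
  rewrite /A -big_split/=; apply: eq_bigr => k _.
  by case: ltngtP.
have b k := residue_indicator_bounds m r (w k) I m0 rm.
rewrite AE; split.
  by rewrite leq_add2r; apply: leq_sum => k _; have /andP[] := b k.
rewrite -[leqRHS]addnA addnAC -[leqRHS]addnAC leq_add2r.
rewrite /N /A /E -!big_split/=; apply: leq_sum => k _.
have /andP[_ +] := b k; rewrite (leqNgt 1); case: (w k < 1)%N => /=; lia.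
Qed.

Lemma sum_ord_interval (n t : nat) :
  (\sum_(k < n.+1 | 1 <= k) (k <= t) = minn n t)%N.
Proof.
elim: n => [|n IH]; first by rewrite big_mkcond big_ord_recr big_ord0 min0n.
by rewrite big_mkcond big_ord_recr/= -big_mkcond IH; lia.
Qed.

(** * Asymptotics of the floor counts *)

Section floor_count_asymptotics.
Context {R : realType} (alpha nu : R) (m r : nat).
Hypotheses (halpha : 0 <= alpha < 1) (hnu : 0 <= nu < 1).
Hypotheses (m0 : (0 < m)%N) (r0 : (0 < r)%N) (rm : (r <= m)%N).

Let quotient n k : R := (n%:R - nu) / k%:R + alpha.
Let A n j := (\sum_(k < n.+1 | 1 <= k) (j <= Num.truncn (quotient n k)))%N.
(* Limit of [A n j / n]; the minimum matters only for [j = 1]. *)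
Let b j : R := Num.min 1 (j%:R - alpha)^-1.
Let S I := \sum_(i < I) (b (r + i * m) - b (r + i * m).+1).
(* [1] for the truncation, [(1 - alpha)^-1] for the shift by [nu]. *)
Let C : R := 1 + (1 - alpha)^-1.

Lemma floor_count_truncn n : (0 < n)%N ->
  floor_count n alpha nu r m =
  (\sum_(k < n.+1 | 1 <= k) (Num.truncn (quotient n k) == r %[mod m]))%N.
Proof.
have /andP[a0 a1] := halpha; have /andP[nu0 nu1] := hnu.
move=> n0; rewrite /floor_count -sum1_card -[RHS]big_mkcondr.
apply: eq_bigl => k; rewrite inE; case: (leqP 1 k) => //= k0.
(* Nonnegativity, from [nu < 1 <= n], lets the integer floor be replaced by the natural
   truncation. *)
have q0 : 0 <= quotient n k.
  have n1 : 1 <= n%:R :> R by rewrite ler1n.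
  by rewrite addr_ge0 ?divr_ge0//; lra.
rewrite truncn_floor q0 -eqz_nat -!modz_nat gez0_abs//.
by rewrite floor_ge0.
Qed.

(** Since [alpha < 1 <= j], the condition [j <= quotient n k] can be solved for [k]: it says
    [k <= (n - nu) / (j - alpha)]. *)
Lemma floor_ge_countE n j : (0 < n)%N -> (0 < j)%N ->
  A n j = minn n (Num.truncn ((n%:R - nu) / (j%:R - alpha))).
Proof.
have /andP[a0 a1] := halpha; have /andP[nu0 nu1] := hnu.
move=> n0 j0; rewrite -sum_ord_interval.
apply: eq_bigr => k k0; congr nat_of_bool.
have n1 : 1 <= n%:R :> R by rewrite ler1n.
have j1 : 1 <= j%:R :> R by rewrite ler1n.
have k1 : 1 <= k%:R :> R by rewrite ler1n.
rewrite !truncn_ge_nat; last 2 first.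
- by rewrite divr_ge0//; lra.
- by rewrite addr_ge0 ?divr_ge0//; lra.
by rewrite -lerBlDr ler_pdivlMr ?ler_pdivlMr 1?mulrC//; lra.
Qed.

Lemma floor_ge_count_bound n j : (0 < n)%N -> (0 < j)%N ->
  `|(A n j)%:R - n%:R * b j| <= C.
Proof.
have /andP[a0 a1] := halpha; have /andP[nu0 nu1] := hnu.
move=> n0 j0; rewrite floor_ge_countE//.
have n1 : 1 <= n%:R :> R by rewrite ler1n.
have j1 : 1 <= j%:R :> R by rewrite ler1n.
have ja : 0 < j%:R - alpha by lra.
set x := _ / _; have x0 : 0 <= x by rewrite divr_ge0; lra.
have /andP[tx xt] := truncn_itv x0; rewrite -natr1 in xt.
have xE : x = n%:R / (j%:R - alpha) - nu / (j%:R - alpha) by rewrite /x mulrBl.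
have v0 : 0 <= nu / (j%:R - alpha) by rewrite divr_ge0; lra.
(* The worst case is [j = 1], which makes the error uniform in [j]. *)
have v1 : nu / (j%:R - alpha) <= (1 - alpha)^-1.
  rewrite -[leRHS]mul1r ler_pM// ?invr_ge0; [lra..|lra|].
  by rewrite lef_pV2 ?posrE; lra.
have bE : n%:R * b j = Num.min n%:R (n%:R / (j%:R - alpha)).
  by rewrite /b minr_pMr// mulr1.
rewrite bE natr_min /C; move: (n%:R / _) xE => y xE; rewrite ler_norml.
by rewrite !minElt; do 2 case: ifPn => ?; lra.
Qed.

(** The minimum in [b] is active only in the first summand for [r = 1], where replacing
    [1 / (1 - alpha)] by 1 costs [1 - 1 / (1 - alpha) = - alpha / (1 - alpha)]. Positivity of [I]
    ensures that this summand is present. *)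
Lemma limit_partial_sum I : (0 < I)%N ->
  S I =
  (if r == 1%N then - alpha / (1 - alpha) else 0) +
  \sum_(i < I) ((r%:R - 1 - alpha + 1 + (i * m)%:R)^-1 -
                (r%:R - 1 - alpha + 2 + (i * m)%:R)^-1).
Proof.
have /andP[a0 a1] := halpha.
have b2 j : (1 < j)%N -> b j = (j%:R - alpha)^-1.
  move=> j1; have j2 : 2 <= j%:R :> R by rewrite (ler_nat _ 2).
  by rewrite /b min_r// invf_le1; lra.
have b1 : b 1 = 1.
  by rewrite /b min_l// invf_ge1; lra.
have t1 i : (r%:R - 1 - alpha + 1 + (i * m)%:R) = (r + i * m)%:R - alpha.
  by rewrite !natrD; ring.
have t2 i : (r%:R - 1 - alpha + 2 + (i * m)%:R) = (r + i * m).+1%:R - alpha.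
  by rewrite -addn1 !natrD; ring.
case: I => // I _; rewrite /S !big_ord_recl/= addrA; congr (_ + _); last first.
  by apply: eq_bigr => i _; rewrite t1 t2 !b2// /bump/=; lia.
rewrite t1 t2 mul0n addn0 (b2 r.+1)// addrA; congr (_ - _).
case: eqP => [->|r1]; last by rewrite add0r b2//; lia.
by rewrite b1; field; lra.
Qed.

(** Each of the [I] differences involves two counts, each off by at most [C]; the upper bound uses
    two more, [A n (r + I * m)] and [A n 1]. *)
Lemma floor_count_error n I : (0 < n)%N ->
  n%:R * S I - (2 * I%:R) * C <= (floor_count n alpha nu r m)%:R <=
  n%:R * (S I + ((r + I * m)%:R - alpha)^-1) + (2 * I%:R + 2) * C.
Proof.
have /andP[a0 a1] := halpha.
move=> n0; rewrite floor_count_truncn//.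
have [lo up] := residue_count_bounds _ (fun k : 'I_n.+1 => 1 <= k)%N
  (fun k => Num.truncn (quotient n k)) m r I m0 rm.
set N := (\sum_(k < _ | _) (_ == _ %[mod m]))%N in lo up *.
have Q1 : (\sum_(k < n.+1 | 1 <= k) 1 = n)%N.
  rewrite -[RHS]minnn -sum_ord_interval; apply: eq_bigr => k _.
  by rewrite -ltnS ltn_ord.
have sA j : (0 < j)%N -> _ := fun j0 => floor_ge_count_bound n j n0 j0.
pose A1 := (\sum_(i < I) A n (r + i * m))%N.
pose A2 := (\sum_(i < I) A n (r + i * m).+1)%N.
have dA : `|A1%:R - A2%:R - n%:R * S I| <= 2 * I%:R * C.
  rewrite /A1 /A2 !natr_sum -sumrB /S mulr_sumr -sumrB.
  rewrite (le_trans (ler_norm_sum _ _ _))//.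
  have -> : 2 * I%:R * C = \sum_(i < I) (2 * C).
    by rewrite sumr_const card_ord -mulr_natr; ring.
  apply: ler_sum => i _.
  have := sA (r + i * m).+1 isT; have := sA (r + i * m)%N.
  rewrite addn_gt0 r0 => /(_ isT).
  by rewrite !ler_norml; lra.
have loR : A1%:R <= N%:R + A2%:R :> R by rewrite -natrD ler_nat.
have upR :
    N%:R + A2%:R + (A n 1)%:R <= A1%:R + (A n (r + I * m))%:R + n%:R :> R.
  by rewrite -!natrD ler_nat -[X in (_ <= _ + X)%N]Q1.
have rI0 : (0 < r + I * m)%N by rewrite addn_gt0 r0.
have rI1 : 1 <= (r + I * m)%:R :> R by rewrite ler1n.
(* Hence [A n 1] is within [C] of [n], so only boundedly many [k] have quotient below 1. *)
have b1 : b 1 = 1 by rewrite /b min_l// invf_ge1; lra.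
have bI : n%:R * b (r + I * m) <= n%:R * ((r + I * m)%:R - alpha)^-1.
  by rewrite ler_wpM2l// /b ge_min lexx orbT.
have := sA 1 isT; have := sA _ rI0; rewrite b1 mulr1.
move: dA; rewrite !ler_norml; lra.
Qed.

Lemma floor_count_cvg :
  (fun n => n%:R^-1 * (floor_count n alpha nu r m)%:R : R) @ \oo -->
  (if r == 1%N then - alpha / (1 - alpha) else 0) +
  \int[@lebesgue_measure R]_(x in `]0, 1[)
    ((1 - x) * x `^ (r%:R - 1 - alpha) / (1 - x ^+ m)).
Proof.
have /andP[a0 a1] := halpha.
have r1 : 1 <= r%:R :> R by rewrite ler1n.
have C0 : 0 < C by rewrite /C addr_gt0// invr_gt0; lra.
set L := _ + _; apply/cvgrPdist_le => e e0.
(* The tail [d] gets half of the tolerance [e]; [I] is fixed before [n], whose size then makes the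
   remaining error at most [n * e / 2]. *)
pose I := (Num.truncn (2 / e)).+1.
have Ie : 2 / e < I%:R.
  by have /andP[] := truncn_itv (divr_ge0 (ler0n R 2) (ltW e0)).
have rI : I%:R <= (r + I * m)%:R - alpha.
  have : I%:R <= (I * m)%:R :> R by rewrite ler_nat leq_pmulr.
  by rewrite natrD; lra.
set d := ((r + I * m)%:R - alpha)^-1.
have de : d <= e / 2.
  have I0 : 0 < I%:R :> R by rewrite ltr0n.
  rewrite /d -[leRHS]invf_div lef_pV2 ?posrE ?divr_gt0//.
    exact: ltW (lt_le_trans Ie rI).
  exact: lt_le_trans I0 rI.
have /andP[LS SL] : S I <= L <= S I + d.
  have s1 : -1 < r%:R - 1 - alpha by lra.
  have /andP[lo up] := Rintegral_kernel_bounds _ m s1 m0 I.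
  have dE : d = (r%:R - 1 - alpha + 1 + (I * m)%:R)^-1.
    by rewrite /d natrD; congr (_^-1); ring.
  rewrite limit_partial_sum// /L -[X in _ && (_ <= X)]addrA !lerD2l dE.
  by apply/andP; split; [exact: lo | exact: up].
near=> n.
have n1 : 2 * (2 * I%:R + 2) * C / e <= n%:R by near: n; exact: nbhs_infty_ger.
have n0 : (0 < n)%N by near: n; exact: nbhs_infty_gt.
have n0R : 0 < n%:R :> R by rewrite ltr0n.
have Ce : (2 * I%:R + 2) * C <= n%:R * (e / 2).
  by move: n1; rewrite ler_pdivrMr//; lra.
have /andP[lo up] := floor_count_error n I n0.
rewrite -(ler_pM2l n0R) -{1}(gtr0_norm n0R) -normrM mulrBr mulVKf ?gt_eqF//.
rewrite ler_norml; move: lo up; rewrite -/d; set N := _%:R.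
(* Up to an error of [n * e / 2], the count lies between [n * S I] and [n * (S I + d)], as [n * L]
   does exactly; so they differ by at most [n * (d + e / 2) <= n * e]. *)
have := ler_wpM2l (ltW n0R) LS; have := ler_wpM2l (ltW n0R) SL.
have := ler_wpM2l (ltW n0R) de.
by lra.
Unshelve. all: by end_near. Qed.

End floor_count_asymptotics.

Theorem corollary4p13 (R : realType) (alpha nu : R) (r : int) (m : nat)
    (halpha : 0 <= alpha < 1) (hnu : 0 <= nu < 1) (hr : 1 <= r <= m%:Z) :
  (fun n : nat => n%:R^-1 * (floor_count n alpha nu r m)%:R : R) @ \oo -->
  (if r == 1
   then - alpha / (1 - alpha) +
        \int[@lebesgue_measure R]_(x in `]0, 1[)
          ((1 - x) * x `^ (- alpha) / (1 - x ^+ m))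
   else \int[@lebesgue_measure R]_(x in `]0, 1[)
          ((1 - x) * x `^ (r%:~R - 1 - alpha) / (1 - x ^+ m))).
Proof.
case: r hr => [r|//] /andP[r0 rm].
have r0' : (0 < r)%N by [].
have := floor_count_cvg alpha nu m r halpha hnu (leq_trans r0' rm) r0' rm.
rewrite eqz_nat; case: eqP => [->|_]; last by rewrite add0r.
by rewrite subrr sub0r.
Qed.
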